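(* Let $d\ge 1$, $\sigma>0$, $w\ge 0$, $x\in\mathbf{R}^d$, $m=\|x\|$, $\mu=N(x,\sigma^2I_d)$ and $\nu=N(0,\sigma^2I_d)$. (i) For $\psi_2(t)=e^{t^2}-1$ and $s=w\sqrt{\log 2}$, with $c^*=\max(0,1-s/m)$, one has $$R^{(w)}_{1,\psi_2}(\mu\|\nu)=R_1\big(N(c^*x,\sigma^2I_d)\,\big\|\,N(0,\sigma^2I_d)\big)=\frac{(m-s)_+^2}{2\sigma^2}.$$ (ii) More generally, for any Orlicz function $\psi$, with $s:=w\,\psi^{-1}(1)$ and $c^*=\max(0,1-s/m)$, $$R^{(w)}_{1,\psi}\big(N(x,\sigma^2I_d)\,\big\|\,N(0,\sigma^2I_d)\big)=\frac{(m-s)_+^2}{2\sigma^2},$$ and the infimum defining $R^{(w)}_{1,\psi}$ is attained at $\mu'=N(c^*x,\sigma^2I_d)$. (If $x=0$, then $c^*x$ is understood to be $0$.)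
   Context: $\|\cdot\|$ is the Euclidean norm on $\mathbf{R}^d$, $N(a,\Sigma)$ is the Gaussian measure with mean $a$ and covariance $\Sigma$, and $t_+=\max(t,0)$. An Orlicz function is a function $\psi:[0,\infty)\to[0,\infty)$ that is convex with $\psi(0)=0$, $\psi(t)>0$ for $t>0$, and $\psi(t)\to\infty$ as $t\to\infty$; $\psi^{-1}:[0,\infty)\to[0,\infty)$ is its inverse function. For an $\mathbf{R}^d$-valued random variable $Z$, the Orlicz norm is $$\|Z\|_\psi:=\inf\{\lambda>0:\ \mathbb{E}\,\psi(\|Z\|/\lambda)\le 1\}$$ (with $\inf\emptyset=+\infty$). For probability measures $\mu,\mu'$ on $\mathbf{R}^d$, with $\Pi(\mu,\mu')$ the set of couplings, the Orlicz--Wasserstein distance is $$W_\psi(\mu,\mu')=\inf\{\|X-Y\|_\psi:\ (X,Y)\sim\pi\in\Pi(\mu,\mu')\}.$$ $R_1(\mu'\|\nu)=\mathrm{KL}(\mu'\|\nu)$ is the Kullback--Leibler divergence: $\int \log\frac{d\mu'}{d\nu}\,d\mu'$ if $\mu'\ll\nu$, and $+\infty$ otherwise. The shifted divergence is $$R^{(w)}_{1,\psi}(\mu\|\nu)=\inf\{R_1(\mu'\|\nu):\ \mu' \text{ a probability measure on } \mathbf{R}^d,\ W_\psi(\mu,\mu')\le w\}.$$ *)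

(* Defs.v *)
From HB Require Import structures.
From mathcomp Require Import all_boot all_order all_algebra.
From mathcomp Require Import all_classical all_reals all_analysis.
From mathcomp Require Import measurable_realfun.

Set Implicit Arguments.
Unset Strict Implicit.
Unset Printing Implicit Defensive.

Import Order.TTheory GRing.Theory Num.Theory.
Import numFieldNormedType.Exports.

Local Open Scope classical_set_scope.
Local Open Scope ring_scope.

Definition measure_rV_display : measure_display.
Proof. exact: (measure_tuple_display default_measure_display). Qed.

(* R^d is 'rV[R]_d with the Borel sigma-algebra, presented as the product
   sigma-algebra of the coordinates, as the library does for d.-tuple. *)
Section measurable_rV.
Context (R : realType) (d : nat).

Definition rV_coord (i : 'I_d) (y : 'rV[R]_d) : measurableTypeR R := y ord0 i.

Let rV_set0 : g_sigma_preimage rV_coord set0.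
Proof. exact: sigma_algebra0. Qed.

Let rV_setC A : g_sigma_preimage rV_coord A -> g_sigma_preimage rV_coord (~` A).
Proof. exact: sigma_algebraC. Qed.

Let rV_bigcup (F : _^nat) : (forall i, g_sigma_preimage rV_coord (F i)) ->
  g_sigma_preimage rV_coord (\bigcup_i (F i)).
Proof. exact: sigma_algebra_bigcup. Qed.

HB.instance Definition _ := @isMeasurable.Build measure_rV_display
  'rV[R]_d (g_sigma_preimage rV_coord) rV_set0 rV_setC rV_bigcup.

Lemma measurable_rV_coord (i : 'I_d) : measurable_fun [set: 'rV[R]_d] (rV_coord i).
Proof.
move=> _ Y mY; rewrite setTI; apply: sub_sigma_algebra => /=.
rewrite -bigcup_seq/=; exists i => /=; first by rewrite mem_index_enum.
by exists Y => //; rewrite setTI.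
Qed.

Lemma measurable_fun_rVP d1 (T : measurableType d1) (f : T -> 'rV[R]_d) :
  (forall i, measurable_fun [set: T] (rV_coord i \o f)) ->
  measurable_fun [set: T] f.
Proof.
move=> mf.
suff : g_sigma_preimage (fun i => rV_coord i \o f) `<=` measurable.
  by rewrite g_sigma_preimage_comp => prefS _ A mA; apply: prefS; exists A.
apply: smallest_sub; first exact: sigma_algebra_measurable.
elim/big_ind: _ => //; first by move=> A B hA hB X [/hA|/hB].
by move=> i _ A [B mB <-]; exact: mf.
Qed.

End measurable_rV.

Section lebesgue_rV.
Context (R : realType).

Definition rV_cons n (p : measurableTypeR R * 'rV[R]_n) : 'rV[R]_n.+1 :=
  row_mx (p.1 : R)%:M p.2.

Lemma measurable_rV_cons n : measurable_fun [set: _] (@rV_cons n).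
Proof.
apply: measurable_fun_rVP => i.
have [j ij|j ij] := @split_ordP 1 n i.
  rewrite (_ : _ \o _ = fst) //; apply/funext => p.
  by rewrite /= /rV_coord /rV_cons ij (row_mxEl (p.1 : R)%:M) !ord1 mxE eqxx.
rewrite (_ : _ \o _ = rV_coord j \o snd).
  by apply: measurableT_comp; [exact: measurable_rV_coord|].
apply/funext => p.
by rewrite /= /rV_coord /rV_cons ij (row_mxEr (p.1 : R)%:M).
Qed.

Definition rV_uncons n (y : 'rV[R]_n.+1) : measurableTypeR R * 'rV[R]_n :=
  (y ord0 ord0, \row_j y ord0 (lift ord0 j)).

Lemma measurable_rV_uncons n : measurable_fun [set: _] (@rV_uncons n).
Proof.
apply: measurable_fun_pair => /=.
  exact: (@measurable_rV_coord R n.+1 ord0).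
apply: measurable_fun_rVP => j.
rewrite (_ : _ \o _ = @rV_coord R n.+1 (lift ord0 j)).
  exact: measurable_rV_coord.
by apply/funext => y; rewrite /rV_coord /= mxE.
Qed.

Lemma rV_consK n : cancel (@rV_cons n) (@rV_uncons n).
Proof.
move=> [a v]; rewrite /rV_uncons /rV_cons /=; congr pair.
  rewrite (_ : ord0 = lshift n (ord0 : 'I_1)); last exact/val_inj.
  by rewrite (row_mxEl (a : R)%:M) mxE eqxx.
apply/rowP => j; rewrite mxE.
rewrite (_ : lift ord0 j = rshift 1 j); last exact/val_inj.
by rewrite (row_mxEr (a : R)%:M).
Qed.

Section step.
Context n (m : {sigma_finite_measure set 'rV[R]_n -> \bar R}).
Let leb1 : {sigma_finite_measure set (measurableTypeR R) -> \bar R} :=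
  @lebesgue_measure R.

Definition lebesgue_rV_step : set 'rV[R]_n.+1 -> \bar R :=
  pushforward (leb1 \x m)%E (@rV_cons n).

Let step0 : lebesgue_rV_step set0 = 0%E.
Proof. by rewrite /lebesgue_rV_step /pushforward preimage_set0 measure0. Qed.

Let step_ge0 A : (0 <= lebesgue_rV_step A)%E.
Proof. by rewrite /lebesgue_rV_step /pushforward measure_ge0. Qed.

Let step_sigma_additive : semi_sigma_additive lebesgue_rV_step.
Proof.
have mcons := @measurable_rV_cons n.
move=> F mF tF mUF; rewrite /lebesgue_rV_step /pushforward preimage_bigcup.
apply: measure_semi_sigma_additive.
- by move=> k; rewrite -[X in measurable X]setTI; exact: mcons.
- apply/trivIsetP => /= i j _ _ ij; rewrite -preimage_setI.
  by move/trivIsetP : tF => /(_ _ _ _ _ ij) ->//; rewrite preimage_set0.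
- by rewrite -preimage_bigcup -[X in measurable X]setTI; exact: mcons.
Qed.

HB.instance Definition _ := isMeasure.Build _ _ _ lebesgue_rV_step
  step0 step_ge0 step_sigma_additive.

Let step_sigma_finite : sigma_finite setT lebesgue_rV_step.
Proof.
have /sigma_finiteP[F [TF ndF Foo]] := sigma_finiteT leb1.
have /sigma_finiteP[G [TG ndG Goo]] := sigma_finiteT m.
exists (fun k => @rV_uncons n @^-1` (F k `*` G k)).
  rewrite -preimage_bigcup [X in _ @^-1` X](_ : _ = setT) ?preimage_setT//.
  apply/seteqP; split => // -[a v] _.
  have : [set: measurableTypeR R] a by [].
  have : [set: 'rV[R]_n] v by [].
  rewrite {1}TG {1}TF => -[l _ Glv] [k _ Fka]; exists (maxn k l) => //; split.
    by move: a Fka; exact/subsetPset/ndF/leq_maxl.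
  by move: v Glv; exact/subsetPset/ndG/leq_maxr.
move=> k; have [mF Fk] := Foo k; have [mG Gk] := Goo k; split.
  rewrite -[X in measurable X]setTI; apply: measurable_rV_uncons => //.
  exact: measurableX.
rewrite /lebesgue_rV_step /pushforward -comp_preimage.
rewrite (_ : rV_uncons (n := n) \o rV_cons (n := n) = id).
  by rewrite preimage_id product_measure1E// lte_mul_pinfty// ge0_fin_numE.
by apply/funext => p /=; rewrite rV_consK.
Qed.

HB.instance Definition _ := Measure_isSigmaFinite.Build _ _ _ lebesgue_rV_step
  step_sigma_finite.

End step.

(* Lebesgue measure on R^n: the n-fold product of [lebesgue_measure]. *)
Fixpoint lebesgue_rV n : {sigma_finite_measure set 'rV[R]_n -> \bar R} :=
  match n with
  | 0 => \d_(0 : 'rV[R]_0)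
  | n'.+1 => lebesgue_rV_step (lebesgue_rV n')
  end.

End lebesgue_rV.

Section gaussian.
Context (R : realType) (d : nat) (a : 'rV[R]_d) (Sigma : 'M[R]_d).

Definition gaussian_pdf (y : 'rV[R]_d) : R :=
  (Num.sqrt ((2 * pi) ^+ d * \det Sigma))^-1 *
  expR (- (((y - a) *m invmx Sigma *m (y - a)^T) ord0 ord0 / 2)).

Lemma gaussian_pdf_ge0 y : 0 <= gaussian_pdf y.
Proof. by rewrite mulr_ge0 ?invr_ge0 ?sqrtr_ge0 ?expR_ge0. Qed.

Lemma measurable_gaussian_pdf : measurable_fun [set: 'rV[R]_d] gaussian_pdf.
Proof.
apply: measurable_funM => //.
apply: measurableT_comp => //; apply: measurableT_comp => //.
apply: measurable_funM => //.
under eq_fun do rewrite mxE.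
have mc i : measurable_fun [set: 'rV[R]_d] (fun y => (y - a) ord0 i).
  under eq_fun do rewrite !mxE.
  by apply: measurable_funB => //; exact: (measurable_rV_coord i).
apply: measurable_sum => j.
apply: measurable_funM; last by under eq_fun do rewrite mxE; exact: mc.
under eq_fun do rewrite mxE.
by apply: measurable_sum => k; apply: measurable_funM => //; exact: mc.
Qed.

Definition gaussian_density_measure (A : set 'rV[R]_d) : \bar R :=
  (\int[lebesgue_rV R d]_(y in A) (gaussian_pdf y)%:E)%E.

Let gdm0 : gaussian_density_measure set0 = 0%E.
Proof. exact: integral_set0. Qed.

Let gdm_ge0 A : (0 <= gaussian_density_measure A)%E.
Proof. by apply: integral_ge0 => y _; rewrite lee_fin gaussian_pdf_ge0. Qed.

Let gdm_sigma_additive : semi_sigma_additive gaussian_density_measure.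
Proof.
move=> F mF tF mUF; rewrite /gaussian_density_measure ge0_integral_bigcup//.
- apply: is_cvg_ereal_nneg_natsum_cond => k _ _.
  by apply: integral_ge0 => y _; rewrite lee_fin gaussian_pdf_ge0.
- apply: measurable_funTS; apply/measurable_EFinP.
  exact: measurable_gaussian_pdf.
- by move=> y _; rewrite lee_fin gaussian_pdf_ge0.
Qed.

HB.instance Definition _ := isMeasure.Build _ _ _ gaussian_density_measure
  gdm0 gdm_ge0 gdm_sigma_additive.

(* N(a, Sigma) for Sigma symmetric positive definite.  In that case the density
   has total mass 1 and [mnormalize] changes nothing: it only makes the measure
   a [probability] for every Sigma (the Dirac mass at a if Sigma is singular). *)
Definition gaussian : probability 'rV[R]_d R :=
  mnormalize gaussian_density_measure (\d_a).

End gaussian.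

Section orlicz.
Context (R : realType).

(* A function on [0, +oo) is encoded as a function on R whose values on
   negative reals are irrelevant. *)
Definition orlicz_function (psi : R -> R) : Prop :=
  [/\ forall t : R, 0 <= t -> 0 <= psi t,
      convex_function (`[0, +oo[%classic : set R^o) psi,
      psi 0 = 0,
      forall t : R, 0 < t -> 0 < psi t &
      psi t @[t --> +oo] --> +oo].

Definition orlicz_inv (psi : R -> R) : R -> R :=
  pinv (`[0, +oo[%classic : set R) psi.

Definition psi2 (t : R) : R := expR (t ^+ 2) - 1.

(* The library norm on matrices is the sup norm. *)
Definition enorm d (y : 'rV[R]_d) : R := Num.sqrt (\sum_i y ord0 i ^+ 2).

Definition orlicz_norm (psi : R -> R) d disp (T : measurableType disp)
    (P : probability T R) (Z : T -> 'rV[R]_d) : \bar R :=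
  ereal_inf [set lambda%:E | lambda in
    [set lambda : R | 0 < lambda /\
                  ('E_P[fun t => psi (enorm (Z t) / lambda)%R] <= 1)%E]].

End orlicz.

Section divergences.
Context (R : realType).

Definition couplings disp (T : measurableType disp) (mu mu' : probability T R) :
    set (probability (T * T)%type R) :=
  [set P | (forall A, measurable A -> pushforward P fst A = mu A) /\
           (forall A, measurable A -> pushforward P snd A = mu' A)].

Definition orlicz_wasserstein (psi : R -> R) d
    (mu mu' : probability 'rV[R]_d R) : \bar R :=
  ereal_inf [set orlicz_norm psi P (fun z => z.1 - z.2)
            | P in couplings mu mu'].

Local Open Scope charge_scope.

Definition KL disp (T : measurableType disp) (mu' nu : probability T R) : \bar R :=
  if `[< mu' `<< nu >]
  then (\int[mu']_t lne ('d (charge_of_finite_measure mu') '/d nu t))%E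
  else +oo%E.

Definition shifted_KL (psi : R -> R) (w : R) d
    (mu nu : probability 'rV[R]_d R) : \bar R :=
  ereal_inf [set KL mu' nu
            | mu' in [set mu' | (orlicz_wasserstein psi mu mu' <= w%:E)%E]].

End divergences.

(* Main.v *)
(* Write t0 for the inverse of psi at 1, so that s = w * t0.  If the coupling
   (X, Y) has Orlicz norm at most w, then Jensen's inequality gives
   E|X - Y| <= w t0 = s, so the mean of mu' is within s of x.  Conversely, a
   deterministic shift by a vector of norm at most s costs at most w, and the
   shift of x to c x is such a shift.  Among measures whose mean is within s of
   x, the Gaussian centred at the point of that ball closest to 0 minimizes the
   divergence to N(0, sigma^2 I): this is the Donsker-Varadhan inequality tested
   on the linear functional y |-> <h, y> with h = (m - s)_+ x / (m sigma^2), whose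
   Gaussian exponential moments are explicit. *)
Require Import Defs.
From HB Require Import structures.
From mathcomp Require Import all_boot all_order all_algebra.
From mathcomp Require Import all_classical all_reals all_analysis.
From mathcomp Require Import measurable_realfun ring lra.

Set Implicit Arguments.
Unset Strict Implicit.
Unset Printing Implicit Defensive.

Import Order.TTheory GRing.Theory Num.Theory.
Import numFieldNormedType.Exports.

Local Open Scope classical_set_scope.
Local Open Scope ring_scope.

(** * Orlicz functions *)

Section orlicz_functions.
Context (R : realType) (psi : R -> R) (psiP : orlicz_function psi).

Lemma orlicz_convex (a b t : R) : 0 <= a -> 0 <= b -> 0 <= t <= 1 ->
  psi (t * a + (1 - t) * b) <= t * psi a + (1 - t) * psi b.
Proof.
move=> a0 b0 t01; have [_ cpsi _ _ _] := psiP.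
case/andP: t01 => t0 t1; have := cpsi (Itv01 t0 t1) a b.
rewrite !inE/= !in_itv/= !andbT => /(_ a0 b0).
by rewrite !convRE.
Qed.

(** The point [b] is the convex combination of [a] and [c] with weight [(c - b) / (c - a)] on [a].
    The comparison of slopes is multiplied out so that it can be used without division. *)
Lemma orlicz_secant (a b c : R) : 0 <= a -> a < b -> b < c ->
  (psi b - psi a) * (c - b) <= (psi c - psi b) * (b - a).
Proof.
move=> a0 ab bc.
have ca : 0 < c - a by lra.
pose t := (c - b) / (c - a).
have t01 : 0 <= t <= 1.
  by rewrite divr_ge0 ?ler_pdivrMr ?mul1r//=; lra.
have /= := orlicz_convex a0 (_ : 0 <= c) t01.
have -> : t * a + (1 - t) * c = b by rewrite /t; field; lra.
move=> /(_ ltac:(lra)).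
rewrite -(ler_pM2r ca).
have -> : (t * psi a + (1 - t) * psi c) * (c - a) =
  psi a * (c - b) + psi c * (b - a) by rewrite /t; field; lra.
by lra.
Qed.

(** For [a > 0] the chord from [0] to [a] has positive slope, and by convexity the next chord, from
    [a] to [b], is at least as steep. *)
Lemma orlicz_lt (a b : R) : 0 <= a -> a < b -> psi a < psi b.
Proof.
move=> a0 ab; have [_ _ psi0 psi_gt0 _] := psiP.
have [a_eq0|a_neq0] := eqVneq a 0.
  by rewrite a_eq0 psi0 psi_gt0// -a_eq0.
have {a_neq0}a_gt0 : 0 < a by rewrite lt0r a_neq0.
have := orlicz_secant (lexx 0) a_gt0 ab; rewrite psi0 !subr0 => h.
have : 0 < (psi b - psi a) * a.
  by apply: lt_le_trans h; rewrite mulr_gt0 ?psi_gt0// subr_gt0.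
by rewrite pmulr_lgt0// subr_gt0.
Qed.

Lemma orlicz_le (a b : R) : 0 <= a -> a <= b -> psi a <= psi b.
Proof.
move=> a0; rewrite le_eqVlt => /predU1P[->//|ab].
exact/ltW/orlicz_lt.
Qed.

(** The slope on [[a, b]] is at most the slope on [[b, B + 1]]. The margin 1 makes the latter
    interval at least 1 long, so its slope is at most [psi (B + 1)]. *)
Lemma orlicz_lipschitz (B a b : R) : 0 <= a -> a < b -> b <= B ->
  psi b - psi a <= psi (B + 1) * (b - a).
Proof.
move=> a0 ab bB; have [psi_ge0 _ _ _ _] := psiP.
have := orlicz_secant a0 ab (_ : b < B + 1); move=> /(_ ltac:(lra)) h.
have ab0 := orlicz_lt a0 ab.
apply: le_trans (_ : (psi (B + 1) - psi b) * (b - a) <= _).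
  by apply: le_trans h; rewrite ler_peMr//; lra.
rewrite ler_wpM2r//; first lra.
by have := psi_ge0 b ltac:(lra); lra.
Qed.

(** The Lipschitz bound reaches the endpoint [0], as the intermediate value theorem in [orlicz_inv1]
    requires. *)
Lemma orlicz_continuous (B : R) : {within `[0, B], continuous psi}.
Proof.
have [psi_ge0 _ _ psi_gt0 _] := psiP.
have [B0|B0] := ltP B 0.
  rewrite set_itv_ge; first exact: continuous_subspace0.
  by rewrite bnd_simp -ltNge.
set K := psi (B + 1); have K0 : 0 < K by apply: psi_gt0; lra.
have lip a b : 0 <= a <= B -> 0 <= b <= B -> `|psi a - psi b| <= K * `|a - b|.
  move=> /andP[a0 aB] /andP[b0 bB].
  have [ab|ba|->] := ltgtP a b; last by rewrite !subrr !normr0 mulr0.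
  - rewrite distrC [in leRHS]distrC.
    rewrite !gtr0_norm ?subr_gt0 ?orlicz_lt//; exact: orlicz_lipschitz.
  - rewrite !gtr0_norm ?subr_gt0 ?orlicz_lt//; exact: orlicz_lipschitz.
apply/subspace_continuousP => x /=; rewrite in_itv/= => xB.
apply/cvgrPdist_le => /= e e0.
near=> y.
have yB : 0 <= y <= B.
  suff : y \in `[0, B] by rewrite in_itv.
  by near: y; exact: withinT.
apply: (le_trans (lip _ _ xB yB)).
rewrite -ler_pdivlMl// mulrC.
near: y; rewrite near_withinE.
have /cvgrPdist_le/(_ (e / K) (divr_gt0 e0 K0)) :
  ((y : R) @[y --> (x : R)] --> (x : R)) by exact: cvg_id.
by apply: filterS => y.
Unshelve. all: by end_near. Qed.

(** [pinv] undoes [psi] on a set where [psi] is injective; strict monotonicity provides this on [[0,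
    +oo[]. *)
Lemma orlicz_invK (t : R) : 0 <= t -> orlicz_inv psi (psi t) = t.
Proof.
move=> t0; apply: pinvKV; last by rewrite inE/= in_itv/= t0.
move=> a b; rewrite !inE/= !in_itv/= !andbT => a0 b0 pab.
have [ab|ba|//] := ltgtP a b.
- by have := orlicz_lt a0 ab; rewrite pab ltxx.
- by have := orlicz_lt b0 ba; rewrite pab ltxx.
Qed.

(** The inverse is meaningful at 1 once 1 has a preimage. The intermediate value theorem supplies
    one, since [psi] starts at 0 and reaches at least 1. *)
Lemma orlicz_inv1 : 0 < orlicz_inv psi 1 /\ psi (orlicz_inv psi 1) = 1.
Proof.
have [psi_ge0 _ psi0 psi_gt0 psiy] := psiP.
have [B [B0 B1]] : exists B : R, 0 <= B /\ 1 <= psi B.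
  have /cvgryPge/(_ 1)[M [_ hM]] := psiy.
  exists (Num.max 0 (M + 1)); split; first by rewrite le_max lexx.
  by apply: hM; rewrite lt_max ltrDl ltr01 orbT.
have [] := @IVT R psi 0 B 1 B0 (@orlicz_continuous B).
  by rewrite psi0 ge_min le_max B1 ler01 orbT.
move=> t; rewrite in_itv/= => /andP[t0 _] pt.
rewrite -pt orlicz_invK// lt0r t0 andbT; split => //.
by apply: contra_eq_neq pt => ->; rewrite psi0 eq_sym oner_neq0.
Qed.

(** With [t0] the inverse at 1, the line is parallel to the chord of [psi] over [[t0, t1]], lowered
    to take the value 1 at [t1]. Outside [[t0, t1]] convexity keeps [psi] above the extended chord;
    inside, the line is at most 1 and [psi] at least 1. *)
Lemma orlicz_minorant (t1 : R) : orlicz_inv psi 1 < t1 ->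
  exists2 k, 0 < k & forall t, 0 <= t -> 1 + k * (t - t1) <= psi t.
Proof.
have [t00 pt0] := orlicz_inv1; set t0 := orlicz_inv psi 1 => t01.
have d0 : 0 < t1 - t0 by rewrite subr_gt0.
have p1 := orlicz_lt (ltW t00) t01.
pose k := (psi t1 - 1) / (t1 - t0).
have k0 : 0 < k by rewrite divr_gt0 // subr_gt0 -pt0.
have kE : psi t1 - 1 = k * (t1 - t0) by rewrite /k; field; lra.
exists k => // t t_ge0.
have [tt0|t0t] := ltP t t0.
  have := orlicz_secant t_ge0 tt0 t01; rewrite pt0 kE.
  rewrite -mulrA (mulrC (t1 - t0)) mulrA ler_pM2r// => h.
  have := ler_wpM2l (ltW k0) (ltW t01); lra.
have [tt1|t1t] := leP t t1.
  apply: (@le_trans _ _ 1); first by rewrite gerDl pmulr_rle0// subr_le0.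
  by rewrite -pt0; exact: orlicz_le (ltW t00) t0t.
have := orlicz_secant (ltW t00) t01 t1t; rewrite pt0 kE.
rewrite -mulrA (mulrC (t1 - t0)) mulrA ler_pM2r// => h; nra.
Qed.

(** A monotone function is measurable, but [psi] is monotone only on [[0, +oo[]; precomposing with
    [Num.max 0] makes it monotone on all of [R] without changing it on the values of [f]. *)
Lemma measurable_orlicz d (T : measurableType d) (f : T -> R) :
  (forall t, 0 <= f t) -> measurable_fun setT f ->
  measurable_fun setT (psi \o f).
Proof.
move=> f0 mf; rewrite (_ : _ \o _ = (psi \o Num.max 0) \o f); last first.
  by apply/funext => t /=; rewrite max_r.
apply: measurableT_comp => //; apply: nondecreasing_measurable => // x y xy /=.
apply: orlicz_le; first by rewrite le_max lexx.
by rewrite ge_max le_max lexx/= le_max xy orbT.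
Qed.

(* Jensen's inequality, with the supporting line replaced by the secant lines of
   [orlicz_minorant], which only lose an arbitrarily small constant. *)
Lemma orlicz_expectation_le d (T : measurableType d) (P : probability T R)
    (f : T -> R) (lambda : R) : 0 < lambda ->
  (forall t, 0 <= f t) -> measurable_fun setT f ->
  (\int[P]_t (psi (f t / lambda))%:E <= 1)%E ->
  (\int[P]_t (f t)%:E <= (lambda * orlicz_inv psi 1)%:E)%E.
Proof.
move=> l0 f0 mf Epsi; have [psi_ge0 _ _ _ _] := psiP.
have [t00 pt0] := orlicz_inv1; set t0 := orlicz_inv psi 1 in t00 pt0 *.
have f0' t : 0 <= f t / lambda by rewrite divr_ge0// ltW.
have mf' : measurable_fun setT (fun t => f t / lambda).
  exact: measurable_funM.
have mpsi := measurable_orlicz f0' mf'.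
apply/lee_addgt0Pr => e e0; rewrite -EFinD.
have {e0} e0 : 0 < e / lambda by rewrite divr_gt0.
(* The point [t1 = t0 + e / lambda] is chosen so that [lambda * t1] exceeds [lambda * t0] by exactly
   [e]. *)
have [k k0 kP] := @orlicz_minorant (t0 + e / lambda) ltac:(rewrite -/t0; lra).
set t1 := t0 + e / lambda in kP.
have t1E : lambda * t0 + e = lambda * t1 by rewrite /t1; field; lra.
have t10 : 0 < t1 by rewrite /t1; lra.
(* The term [k * t1] stands on the right so that both integrands are nonnegative: [f] is not yet
   known to be integrable. *)
have h : (\int[P]_t ((k / lambda)%:E * (f t)%:E + 1) <=
          \int[P]_t ((psi (f t / lambda))%:E + (k * t1)%:E))%E.
  apply: ge0_le_integral => //.
  - move=> t _; apply: adde_ge0 => //; rewrite -EFinM lee_fin.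
    by rewrite mulr_ge0// divr_ge0// ltW.
  - apply: emeasurable_funD => //; apply: emeasurable_funM => //.
    exact/measurable_EFinP.
  - by apply: emeasurable_funD => //; exact/measurable_EFinP.
  - move=> t _; rewrite -EFinM -!EFinD lee_fin.
    have -> : k / lambda * f t = k * (f t / lambda) by rewrite mulrAC mulrA.
    by have := kP _ (f0' t); lra.
move: h; rewrite ge0_integralD//; last 2 first.
  - by move=> t _; rewrite -EFinM lee_fin mulr_ge0// divr_ge0// ltW.
  - by apply: emeasurable_funM => //; exact/measurable_EFinP.
rewrite ge0_integralZl_EFin//; last 3 first.
  - by move=> t _; rewrite lee_fin.
  - exact/measurable_EFinP.
  - by rewrite divr_ge0// ltW.
rewrite ge0_integralD//; last 3 first.
  - by move=> t _; rewrite lee_fin psi_ge0.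
  - exact/measurable_EFinP.
  - by move=> t _; rewrite lee_fin mulr_ge0// ltW.
rewrite !integral_cst//= !probability_setT !mule1 => h.
have {}h : ((k / lambda)%:E * \int[P]_t (f t)%:E + 1 <= 1 + (k * t1)%:E)%E.
  by apply: (le_trans h); rewrite leeD2r.
rewrite addeC leeD2lE// in h.
rewrite t1E -(@lee_pmul2l _ (k / lambda)%:E)//; last by rewrite lte_fin divr_gt0.
apply: (le_trans h); rewrite -EFinM lee_fin le_eqVlt; apply/orP; left; apply/eqP.
by field; lra.
Qed.

End orlicz_functions.

Lemma orlicz_psi2 (R : realType) : orlicz_function (@psi2 R).
Proof.
split.
- by move=> t _; rewrite /psi2 subr_ge0 -[leLHS]expR0 ler_expR sqr_ge0.
- move=> t x y _ _; rewrite !(@convRE R) /psi2 [conv t x y](@convRE R x y t).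
  have a0 : 0 <= t%:num by [].
  have a1 : 0 <= 1 - t%:num by rewrite subr_ge0.
  have := convex_expR t (x ^+ 2) (y ^+ 2); rewrite !convRE.
  rewrite /unstable.onem.
  move: (t%:num) a0 a1 => a a0 a1 h.
  have h' : expR ((a * x + (1 - a) * y) ^+ 2) <=
            expR (a * x ^+ 2 + (1 - a) * y ^+ 2).
    (* The convexity gap of the square is [a * (1 - a) * (x - y) ^+ 2]. *)
    by rewrite ler_expR; have := mulr_ge0 (mulr_ge0 a0 a1) (sqr_ge0 (x - y)); nra.
  by lra.
- by rewrite /psi2 expr0n/= expR0 subrr.
- by move=> t t0; rewrite /psi2 subr_gt0 -[ltLHS]expR0 ltr_expR exprn_gt0.
- apply/cvgryPge => A; exists (Num.max 1 A); split; first exact: num_real.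
  move=> t /=; rewrite gt_max => /andP[t1 At]; rewrite /psi2.
  have := expR_ge1Dx (t ^+ 2); nra.
Qed.

Lemma orlicz_inv_psi2 (R : realType) : orlicz_inv (@psi2 R) 1 = Num.sqrt (ln 2).
Proof.
have e : psi2 (Num.sqrt (ln 2)) = 1 :> R.
  by rewrite /psi2 sqr_sqrtr ?ln_ge0 ?ler1n// lnK ?posrE//; lra.
by rewrite -[in LHS]e (orlicz_invK (@orlicz_psi2 R))// sqrtr_ge0.
Qed.

(** * Densities and the Kullback-Leibler divergence *)

Section density.
Context dd (T : measurableType dd) (R : realType).
Variables (nu : {finite_measure set T -> \bar R})
          (mu : {sigma_finite_measure set T -> \bar R}) (p : T -> R).
Hypotheses (p_ge0 : forall x, 0 <= p x) (mp : measurable_fun setT p).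
Hypothesis nuE :
  forall A, measurable A -> nu A = (\int[mu]_(x in A) (p x)%:E)%E.

Lemma density_dominates : nu `<< mu.
Proof.
apply/null_content_dominatesP => A mA muA0; rewrite nuE//.
by apply: null_set_integral => //; apply/measurable_EFinP/measurable_funTS.
Qed.

Lemma density_ae_eq :
  ae_eq mu setT (Radon_Nikodym_SigmaFinite.f nu mu) (EFin \o p).
Proof.
have numu := density_dominates.
apply: integral_ae_eq => //.
- exact: Radon_Nikodym_SigmaFinite.f_integrable.
- exact/measurable_EFinP.
- by move=> A _ mA; rewrite -Radon_Nikodym_SigmaFinite.f_integral// nuE.
Qed.

(** Change of variables holds for the Radon-Nikodym derivative, which agrees with [p] almost
    everywhere because both have the same integral over every measurable set. *)
Lemma ge0_integral_density (f : T -> \bar R) :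
  (forall x, 0 <= f x)%E -> measurable_fun setT f ->
  (\int[nu]_x f x = \int[mu]_x (f x * (p x)%:E))%E.
Proof.
move=> f0 mf; have numu := density_dominates.
rewrite -(Radon_Nikodym_SigmaFinite.change_of_variables numu f0 measurableT mf).
have mfRN : measurable_fun setT (Radon_Nikodym_SigmaFinite.f nu mu).
  exact: measurable_int (Radon_Nikodym_SigmaFinite.f_integrable numu).
apply: ge0_ae_eq_integral => //.
- exact: emeasurable_funM.
- by apply: emeasurable_funM => //; exact/measurable_EFinP.
- by move=> x _; rewrite mule_ge0// Radon_Nikodym_SigmaFinite.f_ge0.
- by move=> x _; rewrite mule_ge0// lee_fin.
- exact/ae_eqe_mul2l/density_ae_eq.
Qed.

End density.

Lemma measurable_lne (R : realType) : measurable_fun setT (@lne R).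
Proof.
rewrite (_ : @lne R = fun x => if (x <= 0)%E then -oo%E else
    (if x == +oo%E then +oo%E else (ln (fine x))%:E)); last first.
  by apply/funext => -[r| |]//=; rewrite leNye.
apply: measurable_fun_ifT => //.
  exact: measurable_fun_lee.
apply: measurable_fun_ifT => //.
  exact: measurable_fun_eqe.
apply/measurable_EFinP; apply: measurableT_comp => //; exact: measurable_ln.
Qed.

(** Positive and negative parts are compared separately, since [g] may have infinite integral: it
    will be the logarithm of a density. *)
Lemma ae_integrable_le_integral dd (T : measurableType dd) (R : realType)
    (mu : {measure set T -> \bar R}) (f g : T -> \bar R) :
  mu.-integrable setT f -> measurable_fun setT g ->
  {ae mu, forall x, (f x <= g x)%E} ->
  (\int[mu]_x f x <= \int[mu]_x g x)%E.
Proof.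
move=> intf mg fg; have mf := measurable_int _ intf.
rewrite integralE [leRHS]integralE; apply: leeB.
- apply: ae_ge0_le_integral => //; try exact: measurable_funepos.
  apply: filterS fg => x fg _; rewrite !funeposE.
  by rewrite ge_max !le_max fg lexx orbT.
- apply: ae_ge0_le_integral => //; try exact: measurable_funeneg.
  apply: filterS fg => x fg _; rewrite !funenegE.
  by rewrite ge_max !le_max leeN2 fg lexx orbT.
Qed.

(** * The Kullback-Leibler divergence and the Donsker-Varadhan inequality *)

Section kullback_leibler.
Context dd (T : measurableType dd) (R : realType).
Variables (mu' nu : probability T R).
Local Open Scope charge_scope.

Let f := Radon_Nikodym_SigmaFinite.f mu' nu.

(** This trades the derivative in [KL] for the version [f], which is nonnegative and finite at every
    point. The two versions agree [nu]-almost everywhere, hence [mu']-almost everywhere by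
    domination. *)
Lemma KL_Radon_Nikodym : mu' `<< nu ->
  KL mu' nu = (\int[mu']_x lne (f x))%E.
Proof.
move=> dom; rewrite /KL; case: ifPn => [_|/asboolPn//].
have mf : measurable_fun setT f.
  exact: measurable_int (Radon_Nikodym_SigmaFinite.f_integrable dom).
apply: ae_eq_integral => //.
- by apply: measurableT_comp => //; exact: measurable_lne.
- by apply: measurableT_comp => //; exact: measurable_lne.
- apply: (null_dominates_ae_eq measurableT dom).
  apply: (@ae_eq_comp _ _ _ _ _ _ _ (@lne R)); apply: ae_eq_sym.
  exact: ae_eq_Radon_Nikodym_SigmaFinite.
Qed.

(** A density in exponential form vanishes nowhere, so its logarithm is [g] at every point. *)
Lemma KL_density (g : T -> R) : measurable_fun setT g ->
  (forall A, measurable A -> mu' A = \int[nu]_(x in A) (expR (g x))%:E)%E ->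
  KL mu' nu = (\int[mu']_x (g x)%:E)%E.
Proof.
move=> mg mu'E.
have mp : measurable_fun setT (expR \o g) by exact: measurableT_comp.
have p0 x : 0 <= (expR \o g) x by exact: expR_ge0.
have dom := density_dominates mp mu'E.
rewrite (KL_Radon_Nikodym dom).
have mf : measurable_fun setT f.
  exact: measurable_int (Radon_Nikodym_SigmaFinite.f_integrable dom).
apply: ae_eq_integral => //.
- by apply: measurableT_comp => //; exact: measurable_lne.
- exact/measurable_EFinP.
- apply: (null_dominates_ae_eq measurableT dom).
  have := density_ae_eq mp mu'E.
  apply: filterS => x /(_ I) fx _.
  by rewrite /f fx /= leNgt expR_gt0/= expRK.
Qed.

(* One half of the Donsker-Varadhan formula; the integrand is compared with
   [lne f] through [ln r >= u + 1 - exp u / r] at [u = g - K]. *)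
Lemma donsker_varadhan (g : T -> R) (K : R) :
  mu'.-integrable setT (EFin \o g) ->
  (\int[nu]_x (expR (g x))%:E = (expR K)%:E)%E ->
  (\int[mu']_x (g x)%:E - K%:E <= KL mu' nu)%E.
Proof.
move=> intg expg.
have mg : measurable_fun setT g by apply/measurable_EFinP; exact: measurable_int intg.
have [dom|ndom] := pselect (mu' `<< nu); last first.
  by rewrite /KL; case: ifPn => [/asboolP//|_]; rewrite leey.
rewrite (KL_Radon_Nikodym dom).
have f0 := Radon_Nikodym_SigmaFinite.f_ge0 dom.
have ffin := Radon_Nikodym_SigmaFinite.f_fin_num dom.
have mf : measurable_fun setT f.
  exact: measurable_int (Radon_Nikodym_SigmaFinite.f_integrable dom).
pose r x := fine (f x).
have fr x : f x = (r x)%:E by rewrite /r fineK.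
have r0 x : 0 <= r x by rewrite -lee_fin -fr.
have mr : measurable_fun setT r by exact: measurableT_comp.
pose q x := expR (g x - K) / r x.
have q0 x : 0 <= q x by rewrite divr_ge0 ?expR_ge0.
have me : measurable_fun setT (fun x => expR (g x - K)).
  by apply: measurableT_comp => //; exact: measurable_funB.
have mq : measurable_fun setT q.
  apply: measurable_funM => //.
  rewrite (_ : (fun x => _) = (@powR R ^~ (-1)) \o r).
    by apply: measurableT_comp => //; exact: measurable_powR.
  by apply/funext => x /=; rewrite powR_inv1.
(* Only an inequality holds: where [r x = 0] the quotient [q x] is 0 by convention, and the mass of
   [expR (g x - K)] there is lost. *)
have q1 : (\int[mu']_x (q x)%:E <= 1)%E.
  rewrite -(Radon_Nikodym_SigmaFinite.change_of_variables dom)//; last first.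
    exact/measurable_EFinP.
  apply: (@le_trans _ _ (\int[nu]_x ((expR (- K))%:E * (expR (g x))%:E))%E).
    apply: ge0_le_integral => //.
    - by move=> x _; rewrite mule_ge0// lee_fin.
    - by apply: emeasurable_funM => //; exact/measurable_EFinP.
    - apply: emeasurable_funM => //; apply/measurable_EFinP.
      exact: measurableT_comp.
    - move=> x _; rewrite -/f fr -!EFinM lee_fin -expRD addrC /q.
      have [->|rx0] := eqVneq (r x) 0; first by rewrite mulr0 expR_ge0.
      by rewrite divfK.
  rewrite ge0_integralZl_EFin ?expR_ge0//; last first.
    by apply/measurable_EFinP; exact: measurableT_comp.
  by rewrite expg -EFinM -expRD addNr expR0.
have intq : mu'.-integrable setT (EFin \o q).
  apply/integrableP; split; first exact/measurable_EFinP.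
  under eq_integral => x _ do rewrite /= ger0_norm//.
  by rewrite (le_lt_trans q1)// ltry.
have intc : mu'.-integrable setT (EFin \o cst (1 - K)).
  exact: finite_measure_integrable_cst.
have intgc : mu'.-integrable setT (EFin \o (fun x => g x + (1 - K))).
  exact: (@integrableD _ _ _ _ _ _ (EFin \o g) (EFin \o cst (1 - K))).
(* By [q1] the integral of [h] is at least that of [g] minus [K], so it remains to bound [h] by
   [lne f] almost everywhere. *)
pose h x := g x + (1 - K) - q x.
have inth : mu'.-integrable setT (EFin \o h).
  exact: (@integrableB _ _ _ _ _ _ (EFin \o (fun x => g x + (1 - K))) (EFin \o q)).
apply: (@le_trans _ _ (\int[mu']_x (h x)%:E)%E).
  rewrite (integralB_EFin _ intgc intq)//.
  rewrite (integralD_EFin _ intg intc)//.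
  rewrite (integral_cst _ _ (1 - K)%:E)//= probability_setT mule1.
  rewrite -(fineK (integrable_fin_num _ intg))//.
  move: q1; rewrite -(fineK (integrable_fin_num _ intq))//.
  by rewrite -!EFinD !lee_fin => q1; lra.
apply: ae_integrable_le_integral => //.
  by apply: measurableT_comp => //; exact: measurable_lne.
(* The pointwise bound can fail only where [f = 0], a [mu']-null set because its mass is the
   [nu]-integral of [f] over it. *)
have mf0 : measurable [set x | f x = 0%E].
  by rewrite -[X in measurable X]setTI; exact: measurable_eqe.
exists [set x | f x = 0%E]; split => //.
  apply: etrans (Radon_Nikodym_SigmaFinite.f_integral dom mf0) _.
  by apply: integral0_eq => x.
move=> x /=; apply: contra_notP => fx0.
have rx0 : 0 < r x.
  by rewrite lt0r r0 andbT; apply: contra_notN fx0 => /eqP; rewrite fr => ->.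
have rV : (r x)^-1 = expR (- ln (r x)) by rewrite expRN lnK.
rewrite fr lne_EFin// lee_fin /h /q rV -expRD.
by have := expR_ge1Dx (g x - K - ln (r x)); lra.
Qed.

End kullback_leibler.

(** The left side has slope [m] at [t = 0] and the right side has slope 0 there. A single small
    [t = e * m] makes this quantitative. *)
Lemma eq0_ge1D_le_expR (R : realType) (m K : R) :
  (forall t, 1 + t * m <= expR (t ^+ 2 * K)) -> m = 0.
Proof.
move=> h; apply/eqP; apply: contraT => m0.
have m2 : 0 < m ^+ 2 by rewrite exprn_even_gt0.
pose L := 1 + `|K|; have L1 : 1 <= L by rewrite lerDl.
have KL : K <= L by rewrite /L; have := ler_norm K; lra.
(* With [s = e * m ^+ 2], the hypothesis will force [1 <= e * L * (1 + s)]. This [e] gives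
   [e * L * (2 + m ^+ 2) = 1] and [s < m ^+ 2], a contradiction. *)
pose e := (L * (2 + m ^+ 2))^-1.
have D0 : 0 < L * (2 + m ^+ 2) by nra.
have e0 : 0 < e by rewrite invr_gt0.
have eD : e * (L * (2 + m ^+ 2)) = 1 by rewrite /e mulVf// gt_eqF.
have e1 : e < 1 by nra.
have := h (e * m); rewrite -mulrA -expr2 => he.
have hN := expR_ge1Dx (- ((e * m) ^+ 2 * K)).
have eE : expR ((e * m) ^+ 2 * K) * expR (- ((e * m) ^+ 2 * K)) = 1.
  by rewrite -expRD subrr expR0.
have e2 : (e * m) ^+ 2 * K <= e * (e * m ^+ 2) * L.
  by have := ler_wpM2l (ltW (mulr_gt0 (mulr_gt0 e0 e0) m2)) KL; nra.
(* Multiply [he] by the reciprocal exponential, then bound that exponential below by [1 - u]. *)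
have {eE hN he} : (1 + e * m ^+ 2) * (1 - e * (e * m ^+ 2) * L) <= 1.
  rewrite -[leRHS]eE.
  apply: (@le_trans _ _ ((1 + e * m ^+ 2) * expR (- ((e * m) ^+ 2 * K)))).
    rewrite ler_pM2l; nra.
  by rewrite ler_pM2r ?expR_gt0.
set s := e * m ^+ 2; have s0 : 0 < s by rewrite mulr_gt0.
have sm : s < m ^+ 2 by rewrite /s gtr_pMl.
have -> : (1 + s) * (1 - e * s * L) = 1 + s * (1 - e * L * (1 + s)) by ring.
rewrite gerDl pmulr_rle0// subr_le0 => hh.
have eL : 0 < e * L by nra.
suff : e * L * (1 + s) < e * (L * (2 + m ^+ 2)) by rewrite eD; lra.
by rewrite -mulrA ltr_pM2l// ltr_pM2l; lra.
Qed.

(** Integrability follows from [|X| <= exp X + exp (- X)]. Integrating [1 + t X <= exp (t X)] then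
    puts the mean in the scope of [eq0_ge1D_le_expR], so no first moment has to be computed. *)
Lemma subgaussian_centered dd (T : measurableType dd) (R : realType)
    (P : probability T R) (X : T -> R) (K : R) :
  measurable_fun setT X ->
  (forall t, \int[P]_x (expR (t * X x))%:E = (expR (t ^+ 2 * K))%:E)%E ->
  P.-integrable setT (EFin \o X) /\ (\int[P]_x (X x)%:E = 0)%E.
Proof.
move=> mX mgf.
have inte t : P.-integrable setT (EFin \o (fun x => expR (t * X x))).
  apply/integrableP; split.
    apply/measurable_EFinP; apply: measurableT_comp => //.
    exact: measurable_funM.
  under eq_integral => x _ do rewrite /= ger0_norm ?expR_ge0//.
  by rewrite mgf ltry.
have intX : P.-integrable setT (EFin \o X).
  apply: (@le_integrable _ _ _ P setT measurableT _
    ((EFin \o (fun x => expR (1 * X x))) \+ (EFin \o (fun x => expR (- 1 * X x)))))%E.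
  - exact/measurable_EFinP.
  - move=> x _ /=; rewrite lee_fin mul1r mulN1r.
    have a := expR_ge1Dx (X x); have b := expR_ge1Dx (- X x).
    have c := expR_gt0 (X x); have d := expR_gt0 (- X x).
    rewrite [leRHS]ger0_norm; last by rewrite addr_ge0// ltW.
    by rewrite ler_norml; apply/andP; split; lra.
  - exact: integrableD.
split => //.
have fm := integrable_fin_num measurableT intX.
rewrite -(fineK fm); congr EFin; apply: (@eq0_ge1D_le_expR _ _ K) => t.
rewrite -lee_fin -mgf EFinD EFinM (fineK fm) -integralZl//.
rewrite [X in (X + _ <= _)%E](_ : _ = \int[P]_x (cst 1 x)%:E)%E; last first.
  by rewrite (integral_cst _ _ 1%E)//= probability_setT mule1.
have int1 : P.-integrable setT (EFin \o cst (1 : R)).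
  exact: finite_measure_integrable_cst.
have inttX := integrableZl measurableT t intX.
rewrite -integralD//.
apply: le_integral => //; [exact: integrableD|exact: inte|].
by move=> x _; rewrite /= -EFinM -EFinD lee_fin expR_ge1Dx.
Qed.

(** * Lebesgue measure on row vectors *)

Section lebesgue_rV_theory.
Context (R : realType).

Let shiftR (v : R) (x : measurableTypeR R) : measurableTypeR R := (x : R) + v.

Let measurable_shiftR v : measurable_fun setT (shiftR v).
Proof. exact: measurable_funD. Qed.

(** Lebesgue measure is determined by its values on half-open intervals, and translation preserves
    their length. *)
Lemma lebesgue_measure_shift (v : R) (A : set (measurableTypeR R)) :
  measurable A ->
  lebesgue_measure A = pushforward lebesgue_measure (shiftR v) A.
Proof.
pose v_mf : {mfun measurableTypeR R >-> measurableTypeR R} :=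
  HB.pack (shiftR v) (isMeasurableFun.Build _ _ _ _ _ (measurable_shiftR v)).
apply: (lebesgue_measure_unique (mu := pushforward lebesgue_measure v_mf)).
move=> _ [[a b] _ <-] /=; rewrite /pushforward /=.
rewrite [X in _ = lebesgue_measure X](_ : _ = `](a - v), (b - v)]%classic).
  rewrite !lebesgue_measure_itv/= !lte_fin ltrD2r; case: ifPn => // _.
  by rewrite -!EFinD; congr EFin; ring.
by apply/seteqP; split => x /=; rewrite !in_itv/= ltrBlDr lerBrDr.
Qed.

Lemma ge0_integral_shift (f : measurableTypeR R -> \bar R) (v : R) :
  (forall x, 0 <= f x)%E -> measurable_fun setT f ->
  (\int[lebesgue_measure]_x f ((x : R) + v)%R = \int[lebesgue_measure]_x f x)%E.
Proof.
move=> f0 mf; have mv := measurable_shiftR v.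
transitivity (\int[pushforward lebesgue_measure (shiftR v)]_x f x)%E.
  by rewrite ge0_integral_pushforward// preimage_setT.
by apply: eq_measure_integral => A mA _; exact/esym/lebesgue_measure_shift.
Qed.

Lemma ge0_integral_lebesgue_rVS n (f : 'rV[R]_n.+1 -> \bar R) :
  (forall y, 0 <= f y)%E -> measurable_fun setT f ->
  (\int[lebesgue_rV R n.+1]_y f y =
   \int[@lebesgue_measure R]_a \int[lebesgue_rV R n]_v f (rV_cons (a, v)))%E.
Proof.
move=> f0 mf; rewrite /=.
rewrite (@ge0_integral_pushforward _ _ _ _ R _ (@measurable_rV_cons R n))//.
rewrite preimage_setT; apply: fubini_tonelli1 => [|x]; last exact: f0.
by apply: measurableT_comp => //; exact: measurable_rV_cons.
Qed.

Lemma measurable_rV_cons_r n (a : measurableTypeR R) :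
  measurable_fun setT (fun v : 'rV[R]_n => rV_cons (a, v)).
Proof. by apply: measurableT_comp; [exact: measurable_rV_cons|]. Qed.

Lemma measurable_rV_addr n (v : 'rV[R]_n) :
  measurable_fun setT (fun y : 'rV[R]_n => y + v).
Proof.
apply: measurable_fun_rVP => i.
rewrite (_ : _ \o _ = fun y => rV_coord i y + v ord0 i); last first.
  by apply/funext => y; rewrite /rV_coord/= mxE.
by apply: measurable_funD => //; exact: measurable_rV_coord.
Qed.

Lemma measurable_rV_coordR n (i : 'I_n) :
  measurable_fun setT (fun y : 'rV[R]_n => y ord0 i).
Proof. exact: (measurable_rV_coord i). Qed.

Lemma rV_consE0 n (a : R) (v : 'rV[R]_n) : rV_cons (a, v) ord0 ord0 = a.
Proof. by have [] := rV_consK (a, v). Qed.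

Lemma rV_consES n (a : R) (v : 'rV[R]_n) (j : 'I_n) :
  rV_cons (a, v) ord0 (lift ord0 j) = v ord0 j.
Proof. by have [_ /rowP/(_ j)] := rV_consK (a, v); rewrite mxE. Qed.

Lemma rV_consD n (a : R) (v : 'rV[R]_n) (u : 'rV[R]_n.+1) :
  rV_cons (a, v) + u =
  rV_cons (a + u ord0 ord0, v + \row_j u ord0 (lift ord0 j)).
Proof.
apply/rowP => i; rewrite mxE; case: (unliftP ord0 i) => [j|] ->.
  by rewrite !rV_consES !mxE.
by rewrite !rV_consE0.
Qed.

(** Induction on the dimension: Tonelli splits off the first coordinate, the induction hypothesis
    shifts the others, and the one-dimensional result shifts the first. *)
Lemma ge0_integral_rV_shift n (u : 'rV[R]_n) (f : 'rV[R]_n -> \bar R) :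
  (forall y, 0 <= f y)%E -> measurable_fun setT f ->
  (\int[lebesgue_rV R n]_y f (y + u)%R = \int[lebesgue_rV R n]_y f y)%E.
Proof.
elim: n u f => [|n IH] u f f0 mf.
  by apply: eq_integral => y _; rewrite (thinmx0 u) addr0.
have mfu : measurable_fun setT (fun y : 'rV[R]_n.+1 => f (y + u)%R).
  by apply: measurableT_comp => //; exact: measurable_rV_addr.
rewrite ge0_integral_lebesgue_rVS// [RHS]ge0_integral_lebesgue_rVS//.
pose g a := (\int[lebesgue_rV R n]_v f (rV_cons (a, v)))%E.
have mg : measurable_fun setT (g : measurableTypeR R -> _).
  apply: (@measurable_fun_fubini_tonelli_F _ _ _ _ _ _ (f \o @rV_cons R n))
    => [|x]; last exact: f0.
  by apply: measurableT_comp => //; exact: measurable_rV_cons.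
rewrite -[RHS](@ge0_integral_shift _ (u ord0 ord0))//; last first.
  by move=> a; exact: integral_ge0.
apply: eq_integral => a _; under eq_integral do rewrite rV_consD.
rewrite (IH _ (fun v => f (rV_cons (a + u ord0 ord0, v))))//.
by apply: measurableT_comp => //; exact: measurable_rV_cons_r.
Qed.

(** After Tonelli the first factor is constant in the inner integral, which is 1 by induction. In
    dimension 0 the measure is a Dirac mass and the product is empty. *)
Lemma integral_prod1 n (q : 'I_n -> R -> R) :
  (forall i t, 0 <= q i t) -> (forall i, measurable_fun setT (q i)) ->
  (forall i, \int[@lebesgue_measure R]_t (q i t)%:E = 1)%E ->
  (\int[lebesgue_rV R n]_y (\prod_i q i (y ord0 i))%:E = 1)%E.
Proof.
move=> q0 mq q1.
have mprod k (r : 'I_k -> R -> R) : (forall i, measurable_fun setT (r i)) ->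
    measurable_fun setT (fun y : 'rV[R]_k => \prod_i r i (y ord0 i)).
  move=> mr; apply: measurable_prod => i _.
  by apply: measurableT_comp => //; exact: measurable_rV_coordR.
elim: n q q0 mq q1 => [|n IH] q q0 mq q1.
  rewrite /= integral_dirac//; last by apply/measurable_EFinP; exact: mprod.
  by rewrite diracT mul1e big_ord0.
rewrite ge0_integral_lebesgue_rVS; last 2 first.
- by move=> y; rewrite lee_fin prodr_ge0.
- by apply/measurable_EFinP; exact: mprod.
rewrite -[RHS](q1 ord0); apply: eq_integral => a _.
under eq_integral => v _.
  rewrite big_ord_recl rV_consE0 EFinM.
  under eq_bigr do rewrite rV_consES.
  over.
rewrite ge0_integralZl_EFin//; last 2 first.
- by move=> y _; rewrite lee_fin prodr_ge0.
- by apply/measurable_EFinP; exact: (mprod _ (fun i => q (lift ord0 i))).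
by rewrite (IH (fun i => q (lift ord0 i)))// mule1.
Qed.

End lebesgue_rV_theory.

(** * Isotropic Gaussian measures *)

Section euclidean.
Context (R : realType) (d : nat).
Implicit Types (c : R) (h y z : 'rV[R]_d).

Definition dotp h y : R := \sum_i h ord0 i * y ord0 i.

Lemma dotpDr h y z : dotp h (y + z) = dotp h y + dotp h z.
Proof. by rewrite -big_split; apply: eq_bigr => i _; rewrite mxE mulrDr. Qed.

Lemma dotpZl c h y : dotp (c *: h) y = c * dotp h y.
Proof. by rewrite mulr_sumr; apply: eq_bigr => i _; rewrite mxE mulrA. Qed.

Lemma dotpNr h y : dotp h (- y) = - dotp h y.
Proof. by rewrite -sumrN; apply: eq_bigr => i _; rewrite mxE mulrN. Qed.

Lemma dotpC h y : dotp h y = dotp y h.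
Proof. by apply: eq_bigr => i _; rewrite mulrC. Qed.

Lemma enorm_ge0 y : 0 <= enorm y. Proof. exact: sqrtr_ge0. Qed.

Lemma enorm_sqr y : enorm y ^+ 2 = dotp y y.
Proof.
rewrite /enorm sqr_sqrtr; last by apply: sumr_ge0 => i _; exact: sqr_ge0.
by apply: eq_bigr => i _; rewrite expr2.
Qed.

Lemma enormZ c y : enorm (c *: y) = `|c| * enorm y.
Proof.
apply/eqP; rewrite -(@eqrXn2 _ 2)// ?mulr_ge0 ?enorm_ge0//.
by rewrite exprMn real_normK ?num_real// !enorm_sqr dotpZl dotpC dotpZl mulrA.
Qed.

Lemma enormN y : enorm (- y) = enorm y.
Proof. by rewrite -scaleN1r enormZ normrN1 mul1r. Qed.

Lemma enorm_subr_sqr y z :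
  enorm (y - z) ^+ 2 = enorm y ^+ 2 - 2 * dotp z y + enorm z ^+ 2.
Proof.
rewrite !enorm_sqr dotpDr dotpNr !(dotpC (y - z)) !dotpDr !dotpNr (dotpC y z).
by ring.
Qed.

(** Cauchy-Schwarz, from nonnegativity of the quadratic polynomial [enorm (z - c *: h) ^+ 2] in
    [c]. *)
Lemma dotp_le_enorm h z : `|dotp h z| <= enorm h * enorm z.
Proof.
have key c : 0 <= c ^+ 2 * enorm h ^+ 2 - 2 * c * dotp h z + enorm z ^+ 2.
  have := sqr_ge0 (enorm (z - c *: h)).
  by rewrite enorm_subr_sqr enormZ exprMn real_normK ?num_real// dotpZl => ?; lra.
have [h0|h0] := eqVneq (enorm h) 0.
  rewrite h0 mul0r normr_le0; apply/eqP/eqP; apply: contraT => hz.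
  (* When [enorm h = 0] the polynomial is affine in [c]; this [c] would give it the value -1. *)
  have := key ((enorm z ^+ 2 + 1) / (2 * dotp h z)).
  rewrite h0 expr0n/= mulr0 add0r.
  have -> : 2 * ((enorm z ^+ 2 + 1) / (2 * dotp h z)) * dotp h z = enorm z ^+ 2 + 1.
    by field.
  lra.
have h2 : 0 < enorm h ^+ 2 by rewrite exprn_even_gt0.
rewrite -ler_sqr ?nnegrE ?mulr_ge0 ?enorm_ge0// real_normK ?num_real// exprMn.
(* This [c] minimizes the polynomial. *)
have := key (dotp h z / enorm h ^+ 2).
have -> : (dotp h z / enorm h ^+ 2) ^+ 2 * enorm h ^+ 2 -
    2 * (dotp h z / enorm h ^+ 2) * dotp h z + enorm z ^+ 2 =
    (enorm h ^+ 2 * enorm z ^+ 2 - dotp h z ^+ 2) / enorm h ^+ 2 by field.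
by rewrite pmulr_lge0 ?invr_gt0// subr_ge0.
Qed.

Lemma measurable_dotp h : measurable_fun setT (dotp h).
Proof.
by apply: measurable_sum => i; apply: measurable_funM => //; exact: measurable_rV_coordR.
Qed.

Lemma measurable_enorm : measurable_fun setT (@enorm R d).
Proof.
rewrite (_ : @enorm R d = @Num.sqrt R \o (fun y => \sum_i y ord0 i ^+ 2))//.
apply: measurableT_comp.
  apply: nondecreasing_measurable => // x y; exact: ler_wsqrtr.
by apply: measurable_sum => i; apply: measurable_funX; exact: measurable_rV_coordR.
Qed.

End euclidean.

Lemma mnormalize_id dd (T : measurableType dd) (R : realType)
    (mu : {measure set T -> \bar R}) (P : probability T R) :
  mu setT = 1%E -> mnormalize mu P = mu :> (set T -> \bar R).
Proof.
move=> mu1; apply/funext => A.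
by rewrite /mnormalize mu1 onee_eq0/= invr1 mule1.
Qed.

Section integral_indicator.
Context dd (T : measurableType dd) (R : realType).
Variables (mu : {measure set T -> \bar R}) (A : set T).

Lemma measure_integral_indic : measurable A ->
  mu A = (\int[mu]_y (\1_A y)%:E)%E.
Proof. by move=> mA; rewrite integral_indic// setIT. Qed.

Lemma integral_indicM (f : T -> \bar R) :
  (\int[mu]_y ((\1_A y)%:E * f y) = \int[mu]_(y in A) f y)%E.
Proof.
rewrite [RHS]integral_mkcond; apply: eq_integral => y _.
by rewrite patchE indicE; case: (y \in A); rewrite ?mul1e ?mul0e.
Qed.

End integral_indicator.

Lemma probability_integral_cst dd (T : measurableType dd) (R : realType)
    (P : probability T R) (r : R) : (\int[P]_x r%:E = r%:E)%E.
Proof. by rewrite (integral_cst _ _ r%:E)//= probability_setT mule1. Qed.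

(** * Density, exponential moments, means and divergence of isotropic Gaussians *)

Section gaussian_theory.
Context (R : realType) (d : nat) (sigma : R) (sigma_gt0 : 0 < sigma).
Implicit Types (a h v y : 'rV[R]_d).

Let S : 'M[R]_d := (sigma ^+ 2)%:M.
Let sigma_neq0 : sigma != 0. Proof. by rewrite gt_eqF. Qed.

Lemma gaussian_pdf_scalar a y : gaussian_pdf a S y =
  (Num.sqrt ((2 * pi) ^+ d * (sigma ^+ 2) ^+ d))^-1 *
  expR (- (enorm (y - a) ^+ 2 / (2 * sigma ^+ 2))).
Proof.
rewrite /gaussian_pdf det_scalar invmx_scalar mul_mx_scalar -scalemxAl mxE.
congr (_ * expR (- _)).
rewrite enorm_sqr mxE /dotp.
under [in LHS]eq_bigr do rewrite [_^T _ _]mxE.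
rewrite invfM; by field.
Qed.

(** Isotropy splits the density over the coordinates, which reduces the total mass to the
    one-dimensional normal law. *)
Lemma gaussian_pdf_prod a y :
  gaussian_pdf a S y = \prod_i normal_pdf (a ord0 i) sigma (y ord0 i).
Proof.
have s0 : sigma != 0 by rewrite gt_eqF.
under eq_bigr do rewrite normal_pdfE//.
rewrite big_split/= prodr_const card_ord -expR_sum gaussian_pdf_scalar.
congr (_ * expR _).
  rewrite /normal_peak exprVn; congr (_^-1); rewrite -exprMn.
  set u := 2 * pi * sigma ^+ 2.
  have u0 : 0 <= u by rewrite mulr_ge0 ?sqr_ge0// mulr_ge0 ?pi_ge0.
  have -> : sigma ^+ 2 * pi *+ 2 = u by rewrite /u -mulr_natl; ring.
  by rewrite -{1}(sqr_sqrtr u0) exprAC sqrtr_sqr ger0_norm// exprn_ge0// sqrtr_ge0.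
rewrite enorm_sqr /dotp mulr_suml -sumrN; apply: eq_bigr => i _.
by rewrite !mxE -mulr_natl; field.
Qed.

Lemma integral_gaussian_pdf a :
  (\int[lebesgue_rV R d]_y (gaussian_pdf a S y)%:E = 1)%E.
Proof.
under eq_integral do rewrite gaussian_pdf_prod.
apply: (integral_prod1 (q := fun i => normal_pdf (a ord0 i) sigma)).
- by move=> i t; exact: normal_pdf_ge0.
- by move=> i; exact: measurable_normal_pdf.
- by move=> i; exact: integral_normal_pdf.
Qed.

Lemma gaussianE a A :
  gaussian a S A = (\int[lebesgue_rV R d]_(y in A) (gaussian_pdf a S y)%:E)%E.
Proof.
have /(congr1 (@^~ A)) := @mnormalize_id _ _ _ (gaussian_density_measure a S) \d_a
  (integral_gaussian_pdf a).
exact.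
Qed.

Lemma ge0_integral_gaussian a (f : 'rV[R]_d -> \bar R) :
  (forall y, 0 <= f y)%E -> measurable_fun setT f ->
  (\int[gaussian a S]_y f y =
   \int[lebesgue_rV R d]_y (f y * (gaussian_pdf a S y)%:E))%E.
Proof.
move=> f0 mf; apply: ge0_integral_density => //.
- by move=> y; exact: gaussian_pdf_ge0.
- exact: measurable_gaussian_pdf.
- by move=> A mA; exact: gaussianE.
Qed.

(** The log-likelihood ratio of the Gaussian centred at [a] against the one centred at 0. *)
Definition gaussian_tilt a y : R := (dotp a y - enorm a ^+ 2 / 2) / sigma ^+ 2.

Lemma measurable_gaussian_tilt a : measurable_fun setT (gaussian_tilt a).
Proof.
by apply: measurable_funM => //; apply: measurable_funB => //; exact: measurable_dotp.
Qed.

Lemma gaussian_pdf_tilt a y :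
  gaussian_pdf a S y = expR (gaussian_tilt a y) * gaussian_pdf 0 S y.
Proof.
rewrite !gaussian_pdf_scalar [RHS]mulrCA -expRD; congr (_ * expR _).
by rewrite subr0 enorm_subr_sqr /gaussian_tilt; field.
Qed.

Lemma ge0_integral_gaussian_tilt a (f : 'rV[R]_d -> \bar R) :
  (forall y, 0 <= f y)%E -> measurable_fun setT f ->
  (\int[gaussian a S]_y f y =
   \int[gaussian 0 S]_y (f y * (expR (gaussian_tilt a y))%:E))%E.
Proof.
move=> f0 mf; apply: etrans (ge0_integral_gaussian a f0 mf) _.
symmetry; apply: etrans (ge0_integral_gaussian 0 _ _) _.
- by move=> y; rewrite mule_ge0// lee_fin expR_ge0.
- apply: emeasurable_funM => //; apply/measurable_EFinP.
  by apply: measurableT_comp => //; exact: measurable_gaussian_tilt.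
- apply: eq_integral => y _; rewrite -muleA; congr (_ * _)%E.
  by rewrite (gaussian_pdf_tilt a) EFinM.
Qed.

Lemma gaussian_tiltE a A : measurable A ->
  gaussian a S A = (\int[gaussian 0 S]_(y in A) (expR (gaussian_tilt a y))%:E)%E.
Proof.
move=> mA.
apply: etrans (measure_integral_indic (gaussian a S) mA) _.
apply: etrans (ge0_integral_gaussian_tilt a _ _) _.
- by move=> y; rewrite lee_fin.
- by apply/measurable_EFinP; exact: measurable_indic.
- exact: integral_indicM.
Qed.

(** The density depends only on [y - a], and Lebesgue measure is translation invariant. *)
Lemma gaussian_shift a v (f : 'rV[R]_d -> \bar R) :
  (forall y, 0 <= f y)%E -> measurable_fun setT f ->
  (\int[gaussian (a + v) S]_y f y = \int[gaussian a S]_y f (y + v)%R)%E.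
Proof.
move=> f0 mf; apply: etrans (ge0_integral_gaussian (a + v) f0 mf) _.
symmetry; apply: etrans (ge0_integral_gaussian a _ _) _ => [//||].
  by apply: measurableT_comp => //; exact: measurable_rV_addr.
symmetry; apply: etrans (esym (ge0_integral_rV_shift v _ _)) _.
- by move=> y; rewrite mule_ge0// lee_fin gaussian_pdf_ge0.
- apply: emeasurable_funM => //; apply/measurable_EFinP.
  exact: measurable_gaussian_pdf.
apply: eq_integral => y _; congr (_ * _%:E)%E.
have e : y + v - (a + v) = y - a by rewrite opprD addrACA subrr addr0.
by rewrite (gaussian_pdf_scalar (a + v) (y + v)) (gaussian_pdf_scalar a y) e.
Qed.

(** The likelihood ratio towards the mean [sigma ^+ 2 *: h] is [expR (dotp h y - K)], and it
    integrates to 1. *)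
Lemma gaussian_mgf h :
  (\int[gaussian 0 S]_y (expR (dotp h y))%:E =
   (expR (sigma ^+ 2 * enorm h ^+ 2 / 2))%:E)%E.
Proof.
pose K := sigma ^+ 2 * enorm h ^+ 2 / 2.
have tiltE y : gaussian_tilt (sigma ^+ 2 *: h) y = - K + dotp h y.
  rewrite /gaussian_tilt dotpZl enormZ exprMn real_normK ?num_real// /K.
  by field.
have mexp : measurable_fun setT (fun y : 'rV[R]_d => (expR (dotp h y))%:E).
  apply/measurable_EFinP; apply: measurableT_comp => //; exact: measurable_dotp.
have e : (\int[gaussian 0 S]_y ((expR (- K))%:E * (expR (dotp h y))%:E) = 1)%E.
  transitivity (\int[gaussian 0 S]_y
      ((1 : R)%:E * (expR (gaussian_tilt (sigma ^+ 2 *: h) y))%:E))%E.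
    by apply: eq_integral => y _; rewrite mul1e tiltE expRD EFinM.
  apply: etrans (esym (ge0_integral_gaussian_tilt _ _ _)) _ => //.
  exact: probability_integral_cst.
rewrite (ge0_integralZl_EFin _ _ _ mexp) ?expR_ge0// in e.
have K1 : ((expR K)%:E * (expR (- K))%:E = 1)%E.
  by rewrite -EFinM -expRD subrr expR0.
by rewrite -[LHS]mul1e -K1 -muleA e mule1.
Qed.

(** After recentring at [a], [gaussian_mgf] shows that the functional has sub-Gaussian exponential
    moments, hence mean zero. *)
Lemma gaussian_dotp h a :
  (gaussian a S).-integrable setT (EFin \o dotp h) /\
  (\int[gaussian a S]_y (dotp h y)%:E = (dotp h a)%:E)%E.
Proof.
pose X y := dotp h (y - a).
have mX : measurable_fun setT X.
  apply: measurableT_comp; [exact: measurable_dotp|exact: measurable_rV_addr].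
have [] := @subgaussian_centered _ _ _ (gaussian a S) X
  (sigma ^+ 2 * enorm h ^+ 2 / 2) mX.
  move=> t; rewrite -[in LHS](add0r a) gaussian_shift; last 2 first.
  - by move=> y; rewrite lee_fin expR_ge0.
  - by apply/measurable_EFinP; apply: measurableT_comp => //; exact: measurable_funM.
  under eq_integral do rewrite /X addrK -dotpZl.
  rewrite gaussian_mgf enormZ exprMn real_normK ?num_real//.
  by congr (expR _)%:E; ring.
move=> intX X0.
have intc : (gaussian a S).-integrable setT (EFin \o cst (dotp h a)).
  exact: finite_measure_integrable_cst.
have hE : EFin \o dotp h = ((EFin \o X) \+ (EFin \o cst (dotp h a)))%E.
  by apply/funext => y /=; rewrite /X -EFinD -dotpDr subrK.
split; first by rewrite hE; exact: integrableD.
transitivity (\int[gaussian a S]_y ((EFin \o X) \+ (EFin \o cst (dotp h a))) y)%E.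
  by rewrite -hE.
apply: etrans (integralD _ intX intc) _ => //.
by rewrite [X in (X + _)%E]X0 add0e; exact: probability_integral_cst.
Qed.

(** The divergence is the mean of the log-likelihood ratio, an affine function of [dotp a y], whose
    mean under the law centred at [a] is [enorm a ^+ 2]. *)
Lemma KL_gaussian a : KL (gaussian a S) (gaussian 0 S) =
  (enorm a ^+ 2 / (2 * sigma ^+ 2))%:E.
Proof.
rewrite (KL_density (measurable_gaussian_tilt a) (@gaussian_tiltE a)).
have [intd dE] := gaussian_dotp a a.
have intc : (gaussian a S).-integrable setT (EFin \o cst (enorm a ^+ 2 / 2)).
  exact: finite_measure_integrable_cst.
transitivity (\int[gaussian a S]_y
    ((sigma ^+ 2)^-1%:E * ((dotp a y)%:E - (enorm a ^+ 2 / 2)%:E)))%E.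
  by apply: eq_integral => y _; rewrite -EFinB -EFinM mulrC.
apply: etrans (integralZl _ (integrableB _ intd intc) _) _ => //.
rewrite [X in (_ * X)%E](_ : _ = (dotp a a)%:E - (enorm a ^+ 2 / 2)%:E)%E; last first.
  apply: etrans (integralB_EFin _ intd intc) _ => //; congr (_ - _)%E => //.
  exact: probability_integral_cst.
by rewrite -EFinB -EFinM -enorm_sqr; congr EFin; field.
Qed.

End gaussian_theory.

(** * The Orlicz-Wasserstein distance *)

Section image_measure.
Context d1 d2 (T1 : measurableType d1) (T2 : measurableType d2) (R : realType).
Variables (phi : T1 -> T2) (mphi : measurable_fun setT phi).
Variables (P : {measure set T1 -> \bar R}) (mu : {measure set T2 -> \bar R}).
Hypothesis phiP : forall A, measurable A -> pushforward P phi A = mu A.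

Lemma ge0_integral_image (f : T2 -> \bar R) : measurable_fun setT f ->
  (forall y, 0 <= f y)%E -> (\int[mu]_y f y = \int[P]_x f (phi x))%E.
Proof.
move=> mf f0.
transitivity (\int[pushforward P phi]_y f y)%E.
  by apply: eq_measure_integral => A mA _; rewrite -phiP.
by rewrite ge0_integral_pushforward// preimage_setT.
Qed.

Variables (f : T2 -> \bar R) (mf : measurable_fun setT f).

Lemma integrable_image : P.-integrable setT (f \o phi) <-> mu.-integrable setT f.
Proof.
have mabs : measurable_fun setT (fun y => `|f y|%E) by exact: measurableT_comp.
have e := ge0_integral_image mabs (fun=> abse_ge0 _).
split => /integrableP[_ foo]; apply/integrableP; split => //.
- by rewrite e.
- exact: measurableT_comp.
- by rewrite -e.
Qed.

Lemma integral_image : (\int[mu]_y f y = \int[P]_x f (phi x))%E.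
Proof.
rewrite integralE [RHS]integralE; congr (_ - _)%E.
- apply: etrans (ge0_integral_image (measurable_funepos mf) _) _ => //.
  by apply: eq_integral => x _; rewrite !funeposE.
- apply: etrans (ge0_integral_image (measurable_funeneg mf) _) _ => //.
  by apply: eq_integral => x _; rewrite !funenegE.
Qed.

End image_measure.

Section orlicz_wasserstein_theory.
Context (R : realType) (d : nat) (psi : R -> R) (psiP : orlicz_function psi).
Implicit Types (mu : probability 'rV[R]_d R) (h v : 'rV[R]_d).
Let T : measurableType measure_rV_display := 'rV[R]_d.

Lemma measurable_rV_sub : measurable_fun [set: T * T] (fun z : T * T => z.1 - z.2 : T).
Proof.
apply: measurable_fun_rVP => i.
rewrite (_ : _ \o _ = fun z : T * T => z.1 ord0 i - z.2 ord0 i); last first.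
  by apply/funext => z; rewrite /rV_coord/= !mxE.
apply: measurable_funB.
- by apply: (measurableT_comp (measurable_rV_coordR i)).
- by apply: (measurableT_comp (measurable_rV_coordR i)).
Qed.

(** The difference of the functional at the two ends of the coupling is at most [enorm h] times the
    displacement, whose mean is bounded by [orlicz_expectation_le]. The same bound transfers
    integrability from [mu] to [mu']. *)
Lemma coupling_dotp mu mu' (P : probability (T * T)%type R) h (lambda : R) :
  couplings mu mu' P -> 0 < lambda ->
  ('E_P[fun z => psi (enorm (z.1 - z.2) / lambda)%R] <= 1)%E ->
  mu.-integrable setT (EFin \o dotp h) ->
  mu'.-integrable setT (EFin \o dotp h) /\
  (\int[mu]_y (dotp h y)%:E - (enorm h * (lambda * orlicz_inv psi 1))%:E <=
   \int[mu']_y (dotp h y)%:E)%E.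
Proof.
move=> [P1 P2] l0; rewrite unlock => EP inth.
have mZ : measurable_fun [set: T * T] (fun z : T * T => enorm (z.1 - z.2)).
  exact: measurableT_comp (@measurable_enorm R d) measurable_rV_sub.
have Z0 (z : T * T) : 0 <= enorm (z.1 - z.2) by exact: enorm_ge0.
have EZ := orlicz_expectation_le psiP l0 Z0 mZ EP.
have intZ0 : P.-integrable setT (EFin \o (fun z : T * T => enorm (z.1 - z.2))).
  apply/integrableP; split; first exact/measurable_EFinP.
  under eq_integral do rewrite /= ger0_norm//.
  by rewrite (le_lt_trans EZ)// ltry.
have intZ : P.-integrable setT (fun z => (enorm h)%:E * (enorm (z.1 - z.2))%:E)%E.
  exact: (integrableZl measurableT (enorm h) intZ0).
have mh : measurable_fun setT (EFin \o dotp h).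
  by apply/measurable_EFinP; exact: measurable_dotp.
have mD : measurable_fun [set: T * T] (fun z : T * T => dotp h (z.1 - z.2)).
  exact: measurableT_comp (measurable_dotp h) measurable_rV_sub.
have intD : P.-integrable setT (EFin \o (fun z => dotp h (z.1 - z.2))).
  apply: le_integrable intZ => //; first exact/measurable_EFinP.
  move=> z _ /=; rewrite lee_fin.
  by rewrite [leRHS]ger0_norm ?mulr_ge0 ?enorm_ge0//; exact: dotp_le_enorm.
have int1 : P.-integrable setT ((EFin \o dotp h) \o fst).
  exact/(integrable_image measurable_fst P1 mh).
have h2E : (EFin \o dotp h) \o snd =
    (((EFin \o dotp h) \o fst) \- (EFin \o (fun z => dotp h (z.1 - z.2))))%E.
  apply/funext => z /=; rewrite -EFinB dotpDr dotpNr; congr EFin; ring.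
split.
  apply/(integrable_image measurable_snd P2 mh).
  rewrite h2E; exact: integrableB.
rewrite (integral_image measurable_fst P1 mh) (integral_image measurable_snd P2 mh).
have -> : (\int[P]_z (EFin \o dotp h) z.2 = \int[P]_z (EFin \o dotp h) z.1 -
    \int[P]_z (dotp h (z.1 - z.2))%:E)%E.
  rewrite -(integralB _ int1 intD)//.
  by apply: eq_integral => z _; rewrite -[RHS]/((_ \- _)%E z) -h2E.
apply: leeB => //.
apply: (@le_trans _ _ (\int[P]_z ((enorm h)%:E * (enorm (z.1 - z.2))%:E))%E).
  apply: le_integral => //.
  move=> z _; rewrite -EFinM lee_fin (le_trans (ler_norm _))//.
  exact: dotp_le_enorm.
rewrite ge0_integralZl_EFin ?enorm_ge0//; last 2 first.
- by move=> z _; rewrite lee_fin.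
- exact/measurable_EFinP.
by rewrite EFinM lee_wpmul2l// lee_fin enorm_ge0.
Qed.

(** The infima over couplings and over [lambda] may not be attained, so both are approached with
    slack [e], which then tends to 0. *)
Lemma wasserstein_dotp mu mu' h (w : R) :
  (orlicz_wasserstein psi mu mu' <= w%:E)%E ->
  mu.-integrable setT (EFin \o dotp h) ->
  mu'.-integrable setT (EFin \o dotp h) /\
  (\int[mu]_y (dotp h y)%:E - (enorm h * (w * orlicz_inv psi 1))%:E <=
   \int[mu']_y (dotp h y)%:E)%E.
Proof.
move=> Ww inth; have [t0 _] := orlicz_inv1 psiP.
have key e : 0 < e -> mu'.-integrable setT (EFin \o dotp h) /\
    (\int[mu]_y (dotp h y)%:E - (enorm h * ((w + e) * orlicz_inv psi 1))%:E <=
     \int[mu']_y (dotp h y)%:E)%E.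
  move=> e0.
  have : (orlicz_wasserstein psi mu mu' < (w + e)%:E)%E.
    by rewrite (le_lt_trans Ww)// lte_fin ltrDl.
  move=> /ereal_inf_lt[_ [P cP <-]] /ereal_inf_lt[_ [l [l0 EP] <-]].
  rewrite lte_fin => lw; have [? H] := coupling_dotp cP l0 EP inth.
  split => //; apply: le_trans H; apply: leeB => //; rewrite lee_fin.
  by rewrite ler_wpM2l ?enorm_ge0// ler_wpM2r// ltW.
split; first exact: (key 1 ltr01).1.
apply/lee_addgt0Pr => e e0.
(* The added 1 keeps [k] positive when [h = 0]; slack [e / k] then costs at most [e]. *)
pose k := enorm h * orlicz_inv psi 1 + 1.
have k0 : 0 < k by rewrite ltr_wpDl// mulr_ge0 ?enorm_ge0// ltW.
have [int' H] := key (e / k) (divr_gt0 e0 k0).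
move: H; rewrite -(fineK (integrable_fin_num _ inth))//.
rewrite -(fineK (integrable_fin_num _ int'))// -!EFinD !lee_fin => H.
suff : enorm h * orlicz_inv psi 1 * (e / k) <= e by lra.
rewrite mulrCA ler_piMr ?(ltW e0)// ler_pdivrMr// mul1r /k; lra.
Qed.

(** In the coupling of [y] with [y + v] the displacement has constant norm, so the Orlicz condition
    is a bound on the single number [psi (enorm v / lambda)]. *)
Lemma wasserstein_shift mu mu' v (w : R) : 0 <= w ->
  (forall A, measurable A -> pushforward mu (fun y => y + v) A = mu' A) ->
  enorm v <= w * orlicz_inv psi 1 ->
  (orlicz_wasserstein psi mu mu' <= w%:E)%E.
Proof.
move=> w0 mu'E vw; have [t0 pt0] := orlicz_inv1 psiP.
have mphi : measurable_fun [set: T] (fun y : T => (y, y + v) : T * T).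
  by apply: measurable_fun_pair => //; exact: measurable_rV_addr.
pose phi : {mfun T >-> (T * T)%type} :=
  HB.pack (fun y : T => (y, y + v) : T * T) (isMeasurableFun.Build _ _ _ _ _ mphi).
pose P : probability (T * T)%type R := distribution mu phi.
(* The slack makes [lambda = w + e] positive even when [w = 0]. *)
apply/lee_addgt0Pr => e e0.
have we : 0 < w + e by lra.
apply: ge_ereal_inf; exists (orlicz_norm psi P (fun z => z.1 - z.2)).
  by exists P.
apply: ge_ereal_inf; exists (w + e)%:E; last by rewrite -EFinD.
exists (w + e) => //; split => //; rewrite unlock.
have mpsi : measurable_fun [set: T * T]
    (psi \o (fun z : T * T => enorm (z.1 - z.2) / (w + e))).
  apply: measurable_orlicz => //.
    by move=> z; rewrite divr_ge0 ?enorm_ge0// ltW.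
  apply: measurable_funM => //.
  exact: measurableT_comp (@measurable_enorm R d) measurable_rV_sub.
have [psi_ge0 _ _ _ _] := psiP.
rewrite [leLHS](_ : _ = \int[mu]_y (psi (enorm v / (w + e)))%:E)%E; last first.
  pose F (z : T * T) := psi (enorm (z.1 - z.2) / (w + e)).
  apply: etrans (ge0_integral_image (mu := P) (f := EFin \o F) mphi
    (fun _ _ => erefl) _ _) _.
  - exact/measurable_EFinP.
  - by move=> z; rewrite lee_fin psi_ge0// divr_ge0 ?enorm_ge0// ltW.
  - by apply: eq_integral => y _; rewrite /F/= opprD addrA subrr sub0r enormN.
rewrite probability_integral_cst lee_fin -pt0; apply: orlicz_le => //.
  by rewrite divr_ge0 ?enorm_ge0// ltW.
rewrite ler_pdivrMr// (le_trans vw)// mulrC ler_wpM2l//; lra.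
Qed.

End orlicz_wasserstein_theory.

(** * The shifted divergence *)

Section shifted_divergence.
Context (R : realType) (d : nat) (sigma w : R) (x : 'rV[R]_d).
Hypotheses (sigma_gt0 : 0 < sigma) (w_ge0 : 0 <= w).
Variables (psi : R -> R) (psiP : orlicz_function psi).
Let m := enorm x.
Let S : 'M[R]_d := (sigma ^+ 2)%:M.
Let s := w * orlicz_inv psi 1.
(** For [m = 0] the quotient is 0 by convention and [c = 1]; still [c *: x = 0], because then
    [x = 0]. *)
Let c := Num.max 0 (1 - s / m).
Let t := Num.max (m - s) 0.

Let s_ge0 : 0 <= s.
Proof. by rewrite mulr_ge0// ltW//; have [] := orlicz_inv1 psiP. Qed.

Let m_ge0 : 0 <= m. Proof. exact: enorm_ge0. Qed.

Let t_m0 : m = 0 -> t = 0.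
Proof. by move=> m0; rewrite /t m0 sub0r max_r// oppr_le0. Qed.

Lemma shift_factor_le1 : 0 <= c <= 1.
Proof.
by rewrite /c le_max lexx/= ge_max ler01 gerBl divr_ge0.
Qed.

Lemma shift_factor_mul : c * m = t.
Proof.
have [m0|m0] := eqVneq m 0; first by rewrite m0 mulr0 t_m0.
have m_gt0 : 0 < m by rewrite lt0r m0.
by rewrite /c maxr_pMl// mul0r mulrBl mul1r divfK// maxC.
Qed.

(** The displacement has norm [(1 - c) * m = m - t], and [t >= m - s]. *)
Lemma shift_dist : enorm (c *: x - x) <= s.
Proof.
rewrite -[X in _ - X]scale1r -scalerBl enormZ distrC.
have /andP[_ c1] := shift_factor_le1.
rewrite ger0_norm ?subr_ge0// mulrBl mul1r -/m shift_factor_mul /t.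
by rewrite lerBlDr -lerBlDl le_max lexx.
Qed.

Lemma pushforward_gaussian_shift a v A : measurable A ->
  pushforward (gaussian a S) (fun y => y + v) A = gaussian (a + v) S A.
Proof.
move=> mA; symmetry.
apply: etrans (measure_integral_indic (gaussian (a + v) S) mA) _.
have mv : measurable_fun setT (fun y : 'rV[R]_d => y + v) by exact: measurable_rV_addr.
have mA' : measurable ((fun y : 'rV[R]_d => y + v) @^-1` A).
  by rewrite -[X in measurable X]setTI; exact: mv.
apply: etrans (gaussian_shift sigma_gt0 _ _ _ _) _.
- by move=> y; rewrite lee_fin.
- by apply/measurable_EFinP; exact: measurable_indic.
exact: (esym (measure_integral_indic (gaussian a S) mA')).
Qed.

Lemma wasserstein_gaussian_shift :
  (orlicz_wasserstein psi (gaussian x S) (gaussian (c *: x) S) <= w%:E)%E.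
Proof.
apply: (wasserstein_shift psiP (v := c *: x - x)) => //; last exact: shift_dist.
move=> A mA; apply: etrans (pushforward_gaussian_shift _ _ mA) _.
by rewrite subrKC.
Qed.

Lemma KL_gaussian_shift : KL (gaussian (c *: x) S) (gaussian 0 S) =
  (t ^+ 2 / (2 * sigma ^+ 2))%:E.
Proof.
apply: etrans (KL_gaussian sigma_gt0 (c *: x)) _; congr (_ ^+ 2 / _)%:E.
have /andP[c0 _] := shift_factor_le1.
by rewrite enormZ ger0_norm// shift_factor_mul.
Qed.

(* Testing against the linear functional [dotp h], with [h] the multiple of [x]
   of norm [t / sigma ^ 2], is optimal. *)
Lemma KL_gaussian_ge (mu' : probability 'rV[R]_d R) :
  (orlicz_wasserstein psi (gaussian x S) mu' <= w%:E)%E ->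
  ((t ^+ 2 / (2 * sigma ^+ 2))%:E <= KL mu' (gaussian 0 S))%E.
Proof.
move=> Wmu'; have sigma_neq0 : sigma != 0 by rewrite gt_eqF.
have t_ge0 : 0 <= t by rewrite le_max lexx orbT.
pose th := t / sigma ^+ 2; have th_ge0 : 0 <= th by rewrite divr_ge0 ?sqr_ge0.
pose h := (th / m) *: x.
(* For [m = 0] both sides vanish, since then [t = 0]. *)
have thm : th / m * m = th.
  have [m0|m0] := eqVneq m 0; last by rewrite divfK.
  by rewrite m0 mulr0 /th t_m0// mul0r.
have hn : enorm h = th by rewrite enormZ ger0_norm// divr_ge0.
have hx : dotp h x = th * m.
  by rewrite dotpZl -enorm_sqr -/m expr2 mulrA thm.
have [inth Eh] := gaussian_dotp sigma_gt0 h x.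
have [int' E'] := wasserstein_dotp psiP Wmu' inth.
have DV := donsker_varadhan int' (gaussian_mgf sigma_gt0 h).
apply: le_trans DV.
rewrite leeBrDr//; apply: le_trans E'.
rewrite [X in (_ <= X - _)%E]Eh hx hn -/s -EFinD -EFinB lee_fin.
(* Either [t = m - s], or [t = 0] and hence [th = 0]. *)
have -> : th * m - th * s = th * t.
  rewrite -mulrBr /th /t; case: (leP (m - s) 0) => //.
  by rewrite !mul0r.
(* The value [th = t / sigma ^+ 2] maximizes [th * t - sigma ^+ 2 * th ^+ 2 / 2], with maximum
   [t ^+ 2 / (2 * sigma ^+ 2)]. *)
by rewrite le_eqVlt; apply/orP; left; apply/eqP; rewrite /th; field.
Qed.

Lemma shifted_KL_gaussian :
  shifted_KL psi w (gaussian x S) (gaussian 0 S) =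
  (t ^+ 2 / (2 * sigma ^+ 2))%:E.
Proof.
apply/eqP; rewrite eq_le; apply/andP; split.
  rewrite -KL_gaussian_shift; apply: ereal_inf_lbound.
  by exists (gaussian (c *: x) S) => //; exact: wasserstein_gaussian_shift.
by apply: le_ereal_inf_tmp => _ [mu' Wmu' <-]; exact: KL_gaussian_ge.
Qed.

End shifted_divergence.

Theorem theorem4 (R : realType) (d : nat) (sigma w : R) (x : 'rV[R]_d)
    (d_ge1 : (1 <= d)%N) (sigma_gt0 : 0 < sigma) (w_ge0 : 0 <= w) :
  let m := enorm x in
  let mu := gaussian x (sigma ^+ 2)%:M in
  let nu := gaussian 0 (sigma ^+ 2)%:M in
  (let s := w * Num.sqrt (ln 2) in
   let c := Num.max 0 (1 - s / m) in
   let mu' := gaussian (c *: x) (sigma ^+ 2)%:M in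
   shifted_KL (@psi2 R) w mu nu = KL mu' nu /\
   KL mu' nu = ((Num.max (m - s) 0) ^+ 2 / (2 * sigma ^+ 2))%:E) /\
  (forall psi : R -> R, orlicz_function psi ->
   let s := w * orlicz_inv psi 1 in
   let c := Num.max 0 (1 - s / m) in
   let mu' := gaussian (c *: x) (sigma ^+ 2)%:M in
   shifted_KL psi w mu nu =
     ((Num.max (m - s) 0) ^+ 2 / (2 * sigma ^+ 2))%:E /\
   (orlicz_wasserstein psi mu mu' <= w%:E)%E /\
   KL mu' nu = shifted_KL psi w mu nu).
Proof.
move=> m mu nu.
have main psi (psiP : orlicz_function psi) :=
  (shifted_KL_gaussian x sigma_gt0 w_ge0 psiP,
   KL_gaussian_shift x sigma_gt0 w_ge0 psiP).
split; last first.
  move=> psi psiP s c mu'; have [inf_eq KL_eq] := main psi psiP.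
  split; first exact: inf_eq.
  split; first exact: wasserstein_gaussian_shift.
  by rewrite [LHS]KL_eq [RHS]inf_eq.
(* Part (i) is the instance [psi2] of the general case, whose inverse at 1 is the square root of
   [ln 2]. *)
have [inf_eq KL_eq] := main _ (orlicz_psi2 R).
rewrite orlicz_inv_psi2 in inf_eq KL_eq.
by move=> s c mu'; split; [rewrite [RHS]KL_eq|]; [exact: inf_eq|exact: KL_eq].
Qed.
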